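(* For every integer $N\geq 1$, the number of semi-strongly multimodal sequences of size $N$ is equal to the number of multimodal sequences of size $N$ with both of the following properties, where $n$ denotes the peak value of the sequence: (i) the left-hand partition consists entirely of odd parts $<n$; (ii) in the right-hand partition (all of whose parts are $<n$), the parts of size $\leq \lfloor (n-1)/2 \rfloor$ are unrestricted, while each part greater than $\lfloor (n-1)/2 \rfloor$ that appears does so with multiplicity exactly equal to one.
   Context: A multimodal sequence with $k$-fold peak ($k\ge 1$) is a finite nonempty sequence of positive integers whose maximum value $n$ (the peak value) occurs exactly $k$ times, such that the (possibly empty) part before the first occurrence of $n$ (the left-hand partition) is weakly increasing, and the (possibly empty) part after the last occurrence of $n$ (the right-hand partition) is weakly decreasing. All entries other than the $k$ peaks are $<n$. The $k-1$ subsequences between consecutive occurrences of $n$ are arbitrary, possibly empty, finite sequences of positive integers $<n$. A multimodal sequence is one with $k$-fold peak for some $k\ge1$. A semi-strongly multimodal sequence is a multimodal sequence whose left-hand partition is strictly increasing (distinct parts), with no extra restriction on the right-hand partition. The size of a sequence is the sum of its terms. $\lfloor x\rfloor$ is the floor function. *)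

(* Defs.v *)
From mathcomp Require Import all_boot.

Set Implicit Arguments.
Unset Strict Implicit.
Unset Printing Implicit Defensive.

Definition peak (s : seq nat) : nat := \max_(x <- s) x.

Definition left_part (s : seq nat) : seq nat := take (index (peak s) s) s.

Definition right_part (s : seq nat) : seq nat := rev (left_part (rev s)).

Definition kfold_peak (k : nat) (s : seq nat) : bool :=
  [&& s != [::],
      all (fun x => 0 < x) s,
      count_mem (peak s) s == k,
      sorted leq (left_part s) &
      sorted geq (right_part s)].

(* The bound k <= size s costs nothing, since k counts entries of s; it only  *)
(* makes the existential boolean (see multimodalP).                           *)
Definition multimodal (s : seq nat) : bool :=
  [exists k : 'I_(size s).+1, (0 < k) && kfold_peak k s].

Definition semi_strongly_multimodal (s : seq nat) : bool :=
  multimodal s && sorted ltn (left_part s).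

Definition odd_left_part (s : seq nat) : bool := all odd (left_part s).

Definition large_right_parts_once (s : seq nat) : bool :=
  all (fun x => ((peak s - 1) %/ 2 < x) ==> (count_mem x (right_part s) == 1))
      (right_part s).

(* The number of sequences of positive integers of size N satisfying P. Such  *)
(* a sequence has at most N terms, all of them at most N, so it suffices to   *)
(* range over a finite type; see num_of_sizeP.                                *)
Definition num_of_size (P : pred (seq nat)) (N : nat) : nat :=
  #|[set s : N.-bseq 'I_N.+1 |
      let t := [seq val i | i <- s] in
      [&& all (fun x => 0 < x) t, sumn t == N & P t]]|.

Lemma multimodalP (s : seq nat) :
  reflect (exists2 k, 0 < k & kfold_peak k s) (multimodal s).
Proof.
apply: (iffP existsP) => [[k /andP[k0 sk]]|[k k0 sk]]; first by exists (val k).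
have lek : k < (size s).+1.
  by case/and5P: sk => _ _ /eqP <- _ _; rewrite ltnS count_size.
by exists (Ordinal lek); rewrite k0.
Qed.

Lemma num_of_sizeP (P : pred (seq nat)) (N : nat) (l : seq (seq nat)) :
  uniq l ->
  (forall t, (t \in l) = [&& all (fun x => 0 < x) t, sumn t == N & P t]) ->
  num_of_size P N = size l.
Proof.
move=> ul lP; rewrite /num_of_size.
set A := [set _ | _].
pose f (s : N.-bseq 'I_N.+1) := [seq val i | i <- s].
have finj : injective f by move=> s t /(inj_map val_inj) st; apply: val_inj.
rewrite cardE -(size_map f); apply/perm_size/uniq_perm => //.
  by rewrite map_inj_uniq // enum_uniq.
move=> t; rewrite lP; apply/mapP/idP => [[s]|].
  by rewrite mem_enum inE => + ->.
move=> tP; case/and3P: (tP) => tpos /eqP tN _.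
have tsz : size t <= N.
  rewrite -tN; elim: t tpos {tP tN} => //= x t IH /andP[x0 /IH].
  by rewrite -add1n; apply: leq_add.
have tle x : x \in t -> x < N.+1.
  rewrite ltnS -tN; elim: t {tP tpos tN tsz} => //= y t IH.
  rewrite inE => /orP[/eqP->|/IH]; first exact: leq_addr.
  by move=> /leq_trans; apply; apply: leq_addl.
pose u : seq 'I_N.+1 := [seq inord x | x <- t].
have usz : size u <= N by rewrite size_map.
have fu : f (Bseq usz) = t.
  rewrite /f /= /u -map_comp; apply: map_id_in => x /tle xN /=.
  by rewrite inordK.
by exists (Bseq usz) => //; rewrite mem_enum inE -/(f _) /= fu.
Qed.

(* Main.v *)
Require Import Defs.
From mathcomp Require Import all_boot.
From mathcomp Require Import zify.

(** Write a multimodal sequence with peak value n as L ++ K ++ R, where L and R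
are the left-hand and right-hand partitions and K runs from the first to the
last peak.  Leaving K alone, the odd parts of R become the new left-hand
partition, while every even part 2j of R is split into two copies of j, and the
new right-hand partition consists of these together with L.  As L has distinct
parts, the multiplicity of j in the new right-hand partition is [j \in L] plus
twice the multiplicity of 2j in R, so L and R are recovered from its parity and
its half.  The only constraint, that 2j is not in R when 2j >= n, is exactly
condition (ii). *)

(** * Cutting a sequence at its first and last peak *)

(** The strict bounds on [L] and [R] put every occurrence of [n] inside [K], so the two ends of [K]
    are the first and the last peak. With [K != [::]], the default 0 of [head] and [last] is never
    returned. *)
Definition is_split (n : nat) (L K R : seq nat) : bool :=
  [&& all (ltn^~ n) L, all (ltn^~ n) R, all (leq^~ n) K,
      K != [::], head 0 K == n & last 0 K == n].

Definition core (s : seq nat) : seq nat :=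
  drop (size (left_part s)) (take (size s - size (right_part s)) s).

Lemma leq_peak s x : x \in s -> x <= peak s.
Proof. by move=> xs; apply: (@leq_bigmax_seq _ s xpredT id). Qed.

Lemma peak_mem s : s != [::] -> peak s \in s.
Proof.
rewrite /peak; elim: s => // x [|y s] IH _; first by rewrite big_seq1 mem_head.
rewrite big_cons inE; have {}IH := IH isT.
by case: leqP => _; rewrite ?IH ?orbT ?eqxx.
Qed.

Section Split.

Variables (n : nat) (L K R : seq nat).
Hypothesis sp : is_split n L K R.

Lemma peak_split : peak (L ++ K ++ R) = n.
Proof.
case/and5P: sp => /allP lL /allP lR /allP lK + /andP[/eqP hK _].
case: K hK lK => //= k K' -> lK _; apply/eqP.
rewrite eqn_leq leq_peak ?mem_cat ?mem_head ?orbT // andbT.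
apply/bigmax_leqP_seq => x + _; rewrite mem_cat inE mem_cat => /or4P[]; first 1 last.
- by move/eqP->.
- by move=> xK; apply: lK; rewrite inE xK orbT.
- by move/lR/ltnW.
- by move/lL/ltnW.
Qed.

Lemma left_part_split : left_part (L ++ K ++ R) = L.
Proof.
rewrite /left_part peak_split; case/and5P: sp => lL _ _ + /andP[/eqP hK _].
have nL : n \notin L by apply/negP => /(allP lL) /=; rewrite ltnn.
case: K hK => //= k K' -> _.
by rewrite index_cat (negPf nL) /= eqxx addn0 take_size_cat.
Qed.

End Split.

(** Reversal exchanges the two partitions, which transfers [left_part_split] to [right_part]. *)
Lemma is_split_rev n L K R : is_split n L K R -> is_split n (rev R) (rev K) (rev L).
Proof.
rewrite /is_split !all_rev => /and5P[-> -> -> + /andP[hK lK]] /=.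
case/lastP: K hK lK => // K k hK lK _.
rewrite last_rcons in lK; rewrite rev_rcons /= lK /=.
by case: K hK => //= x K; rewrite rev_cons last_rcons.
Qed.

Lemma right_part_split n L K R :
  is_split n L K R -> right_part (L ++ K ++ R) = R.
Proof.
move=> /is_split_rev sp.
by rewrite /right_part !rev_cat -catA (left_part_split _ _ _ _ sp) revK.
Qed.

Lemma core_split n L K R : is_split n L K R -> core (L ++ K ++ R) = K.
Proof.
move=> sp; rewrite /core (left_part_split _ _ _ _ sp) (right_part_split _ _ _ _ sp).
by rewrite catA (size_cat _ R) addnK take_size_cat // drop_size_cat.
Qed.

Lemma split_exists s : s != [::] ->
  exists L K R, s = L ++ K ++ R /\ is_split (peak s) L K R.
Proof.
move=> s0; have := peak_mem s s0; set n := peak s => ns.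
have les x : x \in s -> x <= n by apply: leq_peak.
have lt_take t : {subset t <= s} -> all (ltn^~ n) (take (index n t) t).
  move=> ts; apply/allP => x xt /=; rewrite ltn_neqAle les ?andbT; last first.
    exact/ts/mem_take/xt.
  apply/eqP => xn; have nt : n \in t by rewrite -xn; apply: mem_take xt.
  by move: xt; rewrite xn in_take // ltnn.
(* [t] is the reversed tail of [s] from its first peak on, so the first [n] in [t] is the last peak
   of [s]. *)
pose t := rev (drop (index n s) s).
have tE : rev t = n :: drop (index n s).+1 s.
  by rewrite revK (drop_nth 0) ?index_mem // nth_index.
have nt : n \in t by rewrite -mem_rev tE mem_head.
have ts : {subset t <= s} by move=> x; rewrite mem_rev => /mem_drop.
pose U := drop (index n t) t.
have UE : U = n :: drop (index n t).+1 t.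
  by rewrite /U (drop_nth 0) ?index_mem // nth_index.
exists (take (index n s) s), (rev U), (rev (take (index n t) t)); split.
  by rewrite -rev_cat cat_take_drop revK cat_take_drop.
rewrite /is_split lt_take // all_rev lt_take //= all_rev.
apply/and4P; split.
- by apply/allP => x /mem_drop/ts/les.
- by rewrite UE rev_cons -size_eq0 size_rcons.
(* [rev t] starts with [n] and has [rev U] as a prefix; if that prefix is a single entry, it is the
   [n] that opens [U]. *)
- have := congr1 rev (cat_take_drop (index n t) t); rewrite rev_cat tE -/U.
  by rewrite UE rev_cons; case: (rev (drop _ _)) => [|y q] /= [] *; subst; rewrite eqxx.
- by rewrite UE rev_cons last_rcons.
Qed.

(** The fold [k] is forced to be the number of peaks, which is positive, so the existential
    disappears. *)
Lemma multimodal_split n L K R : is_split n L K R ->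
  multimodal (L ++ K ++ R) =
    [&& all (fun x => 0 < x) (L ++ K ++ R), sorted leq L & sorted geq R].
Proof.
move=> sp; have lE := left_part_split _ _ _ _ sp.
have rE := right_part_split _ _ _ _ sp.
have s0 : L ++ K ++ R != [::].
  by case/and5P: sp => _ _ _ + _; rewrite -!size_eq0 !size_cat; lia.
apply/multimodalP/and3P => [[k _ /and5P[_ -> _]]|[sp0 sL sR]].
  by rewrite lE rE.
exists (count_mem (peak (L ++ K ++ R)) (L ++ K ++ R)).
  by rewrite -has_count has_pred1 peak_mem.
by rewrite /kfold_peak s0 sp0 eqxx lE rE sL.
Qed.

(** * Counting along mutually inverse maps *)

(** Preservation of size is asked of [f] only: for [g] it follows from [f (g t) = t]. *)
Lemma num_of_size_bij (P Q : pred (seq nat)) (f g : seq nat -> seq nat) (N : nat) :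
  (forall t, all (fun x => 0 < x) t -> P t ->
     [/\ all (fun x => 0 < x) (f t), sumn (f t) = sumn t, Q (f t) & g (f t) = t]) ->
  (forall t, all (fun x => 0 < x) t -> Q t ->
     [/\ all (fun x => 0 < x) (g t), P (g t) & f (g t) = t]) ->
  num_of_size P N = num_of_size Q N.
Proof.
move=> fP gP.
have [l ul lP] : exists2 l, uniq l &
    forall t, (t \in l) = [&& all (fun x => 0 < x) t, sumn t == N & P t].
  (* Positive terms with sum [N] are at most [N] in number and in value, so these bounded sequences
     include all candidates. *)
  pose B := undup [seq map val (s : N.-bseq 'I_N.+1) | s <- enum {: N.-bseq 'I_N.+1}].
  exists [seq t <- B | [&& all (fun x => 0 < x) t, sumn t == N & P t]].
    exact/filter_uniq/undup_uniq.
  move=> t; rewrite mem_filter; apply: andb_idr => /and3P[t0 /eqP tN _].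
  have tsz : size t <= N.
    by rewrite -tN; elim: t t0 {tN} => //= x t IH /andP[x0 /IH]; lia.
  have tle x : x \in t -> x <= N.
    rewrite -tN; elim: t {t0 tN tsz} => //= y t IH.
    by rewrite inE => /orP[/eqP->|/IH]; lia.
  have usz : size [seq (inord x : 'I_N.+1) | x <- t] <= N by rewrite size_map.
  rewrite mem_undup; apply/mapP; exists (Bseq usz); first by rewrite mem_enum.
  rewrite /= -map_comp; apply/esym/map_id_in => x /tle xN /=.
  by rewrite inordK.
(* The image of the list [l] under [f] enumerates the sequences counted for [Q]. *)
rewrite (num_of_sizeP ul lP) -(size_map f); apply/esym/num_of_sizeP.
  rewrite map_inj_in_uniq // => s t; rewrite !lP.
  move=> /and3P[s0 _ Ps] /and3P[t0 _ Pt] fst.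
  by have [_ _ _ <-] := fP s s0 Ps; have [_ _ _ <-] := fP t t0 Pt; rewrite fst.
move=> t; apply/mapP/idP => [[s + ->]|/and3P[t0 tN Qt]].
  by rewrite lP => /and3P[s0 sN Ps]; have [-> -> -> _] := fP s s0 Ps; rewrite sN.
have [gt0 Pgt fgt] := gP t t0 Qt; exists (g t) => //.
have [_ sgt _ _] := fP _ gt0 Pgt.
by rewrite lP gt0 Pgt -sgt fgt tN.
Qed.

(** * Sequences given by their multiplicities *)

Definition of_mult (m : nat -> nat) (n : nat) : seq nat :=
  flatten [seq nseq (m i) i | i <- iota 0 n].

Lemma count_of_mult m n (x : nat) : count_mem x (of_mult m n) = if x < n then m x else 0.
Proof.
elim: n => // n IH; rewrite /of_mult -addn1 iotaD map_cat flatten_cat count_cat.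
rewrite -/(of_mult m n) IH /= cats0 count_nseq add0n addn1 ltnS /=.
by case: (ltngtP x n) => [||->]; rewrite ?mul0n ?addn0 ?mul1n.
Qed.

Lemma mem_of_mult m n (x : nat) : (x \in of_mult m n) = (x < n) && (0 < m x).
Proof. by rewrite -has_pred1 has_count count_of_mult; case: (x < n). Qed.

Lemma geq_total : total geq.
Proof. by move=> x y; apply: leq_total. Qed.

Lemma eq_sorted_count (r : rel nat) s t : transitive r -> antisymmetric r ->
  sorted r s -> sorted r t -> (forall x, count_mem x s = count_mem x t) -> s = t.
Proof.
move=> tr ar ss st st_eq; apply: (sorted_eq tr ar ss st).
by apply/allP => x _; apply/eqP/st_eq.
Qed.

(** A sorted sequence is determined by its multiplicities; this and [eq_sort_geq] reduce the four
    inversion identities below to arithmetic on [count_mem]. *)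
Lemma eq_sort_leq s t :
  sorted leq t -> (forall x, count_mem x s = count_mem x t) -> sort leq s = t.
Proof.
move=> st st_eq; apply: (eq_sorted_count leq) => //.
- exact: leq_trans.
- exact: anti_leq.
- exact/sort_sorted/leq_total.
- by move=> x; rewrite -st_eq; apply/permP; rewrite perm_sort.
Qed.

Lemma eq_sort_geq s t :
  sorted geq t -> (forall x, count_mem x s = count_mem x t) -> sort geq s = t.
Proof.
move=> st st_eq; apply: (eq_sorted_count geq) => //.
- by move=> y x z xy yz; apply: leq_trans yz xy.
- by move=> x y /andP[xy yx]; apply: anti_leq; rewrite [x <= y]yx; apply: xy.
- exact/sort_sorted/geq_total.
- by move=> x; rewrite -st_eq; apply/permP; rewrite perm_sort.
Qed.

Lemma count_sort r s (x : nat) : count_mem x (sort r s) = count_mem x s.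
Proof. by apply/permP; rewrite perm_sort. Qed.

Lemma sumn_sort r (s : seq nat) : sumn (sort r s) = sumn s.
Proof. by apply: perm_sumn; rewrite perm_sort. Qed.

(** * Splitting even parts, and the two maps *)

Definition halves (R : seq nat) : seq nat := [seq i./2 | i <- R & ~~ odd i].

Lemma count_halves R (x : nat) : count_mem x (halves R) = count_mem x.*2 R.
Proof.
elim: R => //= y R IH; rewrite /halves /=.
by case: ifP => /= yo; rewrite -/(halves R) IH; lia.
Qed.

(** An even part equals twice its half, hence two copies of [halves R] weigh as much as the even
    parts: the forward map preserves size. *)
Lemma sumn_halves R : sumn (filter odd R) + (sumn (halves R)).*2 = sumn R.
Proof.
elim: R => //= y R <-; rewrite /halves /=.
by case: ifP => /= yo; rewrite -/(halves R); lia.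
Qed.

Lemma mem_halves R (x : nat) : (x \in halves R) = (x.*2 \in R).
Proof. by rewrite -!has_pred1 !has_count count_halves. Qed.

Lemma count_filter_odd R (x : nat) :
  count_mem x (filter odd R) = if odd x then count_mem x R else 0.
Proof.
elim: R => [|y R IH] /=; first by case: ifP.
case: ifP => yo /=; rewrite IH; case: ifP => xo //.
  by rewrite (_ : y == x = false) //; apply/eqP => yx; rewrite yx xo in yo.
by rewrite (_ : y == x = false) //; apply/eqP => yx; rewrite yx xo in yo.
Qed.

Definition odd_left (R : seq nat) : seq nat := sort leq (filter odd R).

Definition merged_right (L R : seq nat) : seq nat :=
  sort geq (L ++ halves R ++ halves R).

Definition distinct_left (n : nat) (R : seq nat) : seq nat :=
  sort leq (of_mult (fun j => odd (count_mem j R)) n).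

(** An even [j] occurs once for each pair of copies of [j./2] in [R]. The cut-off at [n] keeps all
    parts below the peak, for any [L] and [R]. *)
Definition doubled_right (n : nat) (L R : seq nat) : seq nat :=
  sort geq (of_mult (fun j => if odd j then count_mem j L
                              else (count_mem j./2 R)./2) n).

Definition to_odd (s : seq nat) : seq nat :=
  odd_left (right_part s) ++ core s ++ merged_right (left_part s) (right_part s).

Definition of_odd (s : seq nat) : seq nat :=
  distinct_left (peak s) (right_part s) ++ core s
    ++ doubled_right (peak s) (left_part s) (right_part s).

Lemma count_merged_right L R (x : nat) :
  count_mem x (merged_right L R) = count_mem x L + (count_mem x.*2 R).*2.
Proof. by rewrite count_sort !count_cat count_halves addnn. Qed.

Lemma count_ltn_seq n s (x : nat) : all (ltn^~ n) s -> n <= x -> count_mem x s = 0.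
Proof.
by move=> /allP sn nx; apply/count_memPn/negP => /sn /=; rewrite ltnNge nx.
Qed.

(** * The maps keep the peak and invert each other *)

Lemma is_split_to_odd n L K R :
  is_split n L K R -> is_split n (odd_left R) K (merged_right L R).
Proof.
move=> /and3P[/allP lL /allP lR sK]; apply/and3P; split=> //; apply/allP => x.
  by rewrite mem_sort mem_filter => /andP[_ /lR].
rewrite mem_sort !mem_cat orbb mem_halves => /orP[/lL//|/lR/=].
by lia.
Qed.

Lemma is_split_of_odd n L K R L' R' :
  is_split n L K R -> is_split n (distinct_left n R') K (doubled_right n L' R').
Proof.
move=> /and3P[_ _ sK]; apply/and3P; split=> //; apply/allP => x.
  by rewrite mem_sort mem_of_mult => /andP[].
by rewrite mem_sort mem_of_mult => /andP[].
Qed.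

(** The copies coming from [halves R] contribute an even number, so the parity of the multiplicity
    of [x] is its membership in [L]. *)
Lemma distinct_left_merged n L R : all (ltn^~ n) L -> sorted ltn L ->
  distinct_left n (merged_right L R) = L.
Proof.
move=> Ln; rewrite ltn_sorted_uniq_leq => /andP[uL sL].
apply: eq_sort_leq => // x; rewrite count_of_mult count_merged_right.
rewrite (count_uniq_mem _ uL) oddD odd_double addbF oddb; case: ltnP => // nx.
by rewrite -(count_uniq_mem _ uL) (count_ltn_seq _ _ _ Ln nx).
Qed.

(** For even [x], the multiplicity of [x./2] in the merged partition is a bit plus twice that of [x]
    in [R]; halving removes the bit. *)
Lemma doubled_right_odd_left n L R : all (ltn^~ n) R -> uniq L -> sorted geq R ->
  doubled_right n (odd_left R) (merged_right L R) = R.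
Proof.
move=> Rn uL sR.
apply: eq_sort_geq => // x.
rewrite count_of_mult count_merged_right (count_uniq_mem _ uL).
rewrite count_sort count_filter_odd.
case: ltnP => [_|nx]; last by rewrite (count_ltn_seq _ _ _ Rn nx).
by case: ifP => xo; rewrite ?xo // half_bit_double halfK xo subn0.
Qed.

Lemma odd_left_doubled n L R : all (ltn^~ n) L -> sorted leq L -> all odd L ->
  odd_left (doubled_right n L R) = L.
Proof.
move=> Ln sL /allP oL.
apply: eq_sort_leq => // x; rewrite count_filter_odd count_sort count_of_mult.
case: ifP => xo; last by apply/esym/count_memPn/negP => /oL; rewrite xo.
by case: ltnP => nx; rewrite ?xo // (count_ltn_seq _ _ _ Ln nx).
Qed.

(** A multiplicity [c] comes back as [odd c + (c./2).*2]. The second term is cut off when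
    [n <= x.*2], where [c <= 1] makes it zero anyway. *)
Lemma merged_right_distinct n L R : all (ltn^~ n) R -> sorted geq R ->
  (forall x, n <= x.*2 -> count_mem x R <= 1) ->
  merged_right (distinct_left n R) (doubled_right n L R) = R.
Proof.
move=> Rn sR R1.
apply: eq_sort_geq => // x.
rewrite !count_cat count_halves addnn !count_sort !count_of_mult odd_double doubleK.
have := R1 x; have := count_ltn_seq _ _ x Rn.
move: (count_mem x R) => c; case: (ltnP x n); case: (ltnP x.*2 n); lia.
Qed.

(** * Condition (ii) and the bijection *)

(** For positive [x], exceeding [(n - 1) %/ 2] amounts to [n <= x.*2], and a part that appears has
    multiplicity one as soon as it has at most one. *)
Lemma large_right_parts_once_split n L K R : is_split n L K R ->
  large_right_parts_once (L ++ K ++ R) <->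
  (forall x, n <= x.*2 -> count_mem x R <= 1).
Proof.
move=> sp; rewrite /large_right_parts_once (peak_split _ _ _ _ sp).
rewrite (right_part_split _ _ _ _ sp); split=> [/allP R1 x nx|R1].
  have [xR|/count_memPn->//] := boolP (x \in R).
  (* For [x = 0] the bound gives [n = 0], against [x < n]. *)
  case: (posnP x) => [x0|x0].
    by have /and3P[_ /allP/(_ _ xR) /= xn _] := sp; lia.
  by have /implyP/(_ _)/eqP-> := R1 _ xR => //; lia.
apply/allP => x xR; apply/implyP => nx.
have := R1 x; have : 0 < count_mem x R by rewrite -has_count has_pred1.
by lia.
Qed.

Theorem theorem8 (N : nat) (hN : 1 <= N) :
  num_of_size semi_strongly_multimodal N =
  num_of_size
    (fun s => [&& multimodal s, odd_left_part s & large_right_parts_once s]) N.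
Proof.
apply: (num_of_size_bij _ _ to_odd of_odd) => t t0.
- case/andP => mt; have /split_exists[L [K [R [tE sp]]]] : t != [::].
    by case/multimodalP: mt => k _ /and5P[].
  rewrite /to_odd; move: mt t0; move: (peak t) sp => n sp.
  rewrite tE (multimodal_split _ _ _ _ sp) (left_part_split _ _ _ _ sp).
  rewrite (right_part_split _ _ _ _ sp) (core_split _ _ _ _ sp).
  move=> /and3P[_ sL sR] t0 ltL.
  have sp' := is_split_to_odd _ _ _ _ sp; have /and3P[Ln Rn _] := sp.
  have uL : uniq L by move: ltL; rewrite ltn_sorted_uniq_leq => /andP[].
  have pos : all (fun x => 0 < x) (odd_left R ++ K ++ merged_right L R).
    move: t0; rewrite !all_cat !all_sort => /and3P[L0 -> R0].
    rewrite !all_cat L0 andbb; apply/and3P; split=> //.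
      by apply/allP => x; rewrite mem_filter => /andP[_ /(allP R0)].
    by apply/allP => x; rewrite mem_halves => /(allP R0) /=; lia.
  split=> //.
  + rewrite !sumn_cat !sumn_sort !sumn_cat -(sumn_halves R); lia.
  + rewrite (multimodal_split _ _ _ _ sp') pos /odd_left_part.
    rewrite (left_part_split _ _ _ _ sp') !sort_sorted ?all_sort ?filter_all //=.
    (* If [n <= x.*2], then [x.*2] is too large to be in [R], so [x] comes only from the distinct
       parts of [L]. *)
    * apply/(large_right_parts_once_split _ _ _ _ sp') => x nx.
      rewrite count_merged_right (count_ltn_seq _ _ _ Rn nx) addn0.
      by rewrite count_uniq_mem // leq_b1.
    * exact: geq_total.
    * exact: leq_total.
  + rewrite /of_odd (peak_split _ _ _ _ sp') (left_part_split _ _ _ _ sp').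
    rewrite (right_part_split _ _ _ _ sp') (core_split _ _ _ _ sp').
    by rewrite distinct_left_merged // doubled_right_odd_left.
- case/and3P => mt; have /split_exists[L [K [R [tE sp]]]] : t != [::].
    by case/multimodalP: mt => k _ /and5P[].
  rewrite /of_odd; move: mt t0; move: (peak t) sp => n sp.
  rewrite tE (multimodal_split _ _ _ _ sp) /odd_left_part.
  rewrite (left_part_split _ _ _ _ sp) (right_part_split _ _ _ _ sp).
  rewrite (core_split _ _ _ _ sp) => /and3P[_ sL sR] t0 oL.
  move=> /(large_right_parts_once_split _ _ _ _ sp) R1.
  have sp' := is_split_of_odd _ _ _ _ L R sp; have /and3P[Ln Rn _] := sp.
  have pos : all (fun x => 0 < x) (distinct_left n R ++ K ++ doubled_right n L R).
    move: t0; rewrite !all_cat !all_sort => /and3P[_ -> /allP R0].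
    (* The part 0 cannot arise: a new part is odd, or it or its half occurs in [R]. *)
    rewrite andTb; apply/andP; split; apply/allP => x; rewrite mem_of_mult => /andP[_].
      by rewrite lt0b => /odd_gt0; rewrite -has_count has_pred1 => /R0.
    case: ifP => [/odd_gt0//|_ c0].
    have /R0 /= : x./2 \in R by rewrite -has_pred1 has_count; lia.
    by lia.
  split=> //.
  + rewrite /semi_strongly_multimodal (multimodal_split _ _ _ _ sp') pos.
    rewrite (left_part_split _ _ _ _ sp') ltn_sorted_uniq_leq.
    rewrite !sort_sorted ?sort_uniq /=; [|exact: geq_total|exact: leq_total].
    (* Each multiplicity is a boolean, so the new left-hand parts are distinct. *)
    rewrite andbT; apply/count_mem_uniq => x; rewrite count_of_mult mem_of_mult.
    by case: ltnP => //= _; rewrite lt0b.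
  + rewrite /to_odd (left_part_split _ _ _ _ sp') (right_part_split _ _ _ _ sp').
    rewrite (core_split _ _ _ _ sp').
    by rewrite odd_left_doubled // merged_right_distinct.
Qed.
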